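(* Let $A\in\mathbb{R}^{n\times n}$ be strictly stable, and let $\mathcal{R}\subseteq\mathbb{R}^n$ be a closed convex set with nonempty interior such that $\mathcal{R}=\bigcap_{i=1}^N \mathcal{E}_i$ and $\mathcal{R}\subseteq\mathrm{conv}(\mathcal{F}_1\cup\dots\cup\mathcal{F}_M)$, where each $\mathcal{E}_i$ is an ellipsoid, each $\mathcal{F}_i$ is an ellipsoid or a singleton, and $E_1,\ldots,E_N,F_1,\ldots,F_M$ are convex quadratic functions on $\mathbb{R}^n$ with $\mathcal{E}_i=\{x: E_i(x)\le 0\}$ for $i=1,\dots,N$ and $\mathcal{F}_i=\{x: F_i(x)\le 0\}$ for $i=1,\dots,M$. Assume $0\in\mathrm{int}\,\mathcal{R}$. Let $V,W$ be convex quadratic functions on $\mathbb{R}^n$, let $\lambda_1,\ldots,\lambda_M\ge0$, $\mu_1,\ldots,\mu_N\ge0$, $\nu_1,\ldots,\nu_N\ge0$ and $r\in\mathbb{R}$ be scalars, and suppose that for all $x\in\mathbb{R}^n$: \begin{align*} &V(x)\le 1+\lambda_iF_i(x)\quad\text{for all } i\in\{1,\dots,M\},\\ &V(x)\ge r+\mu_iE_i(x)\quad\text{for all } i\in\{1,\dots,N\},\\ &\mathcal{L}_AW(x)\le 0,\\ &W(x)\ge \nu_iE_i(x)\quad\text{for all } i\in\{1,\dots,N\},\\ &\mathcal{L}_AV(x)\le g(x)-W(x), \end{align*} where $g$ is one of the two functions specified below. (1) If $g(x)=-1$ for all $x$, then for every $x_0\in\mathcal{R}$, $$t_*(x_0,\mathcal{R};A)\le\max(V(x_0)-r,0)\le\max(1-r,0).$$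 (2) If $g(x)=-2\gamma V(x)$ for all $x$, for some fixed $\gamma>0$, and if $r>0$, then for every $x_0\in\mathcal{R}$, $$t_*(x_0,\mathcal{R};A)\le\frac{\log^+\big(\frac{V(x_0)}{r}\big)}{2\gamma}\le\frac{\log^+\big(\frac1r\big)}{2\gamma},$$ where $\log^+(\alpha)=\log(\max(\alpha,1))$.
   Context: A matrix $A$ is strictly stable if all its eigenvalues have negative real part. A quadratic function on $\mathbb{R}^n$ is a function of the form $V(x)=x^\top Qx+2b^\top x+c$ with $Q=Q^\top\in\mathbb{R}^{n\times n}$, $b\in\mathbb{R}^n$, $c\in\mathbb{R}$; it is convex if $Q\succeq0$ (so $Q$ may be singular or zero). ''Ellipsoid'' is understood in the broad sense: a set of the form $\{x\in\mathbb{R}^n: V(x)\le0\}$ with $V$ a convex quadratic function, possibly degenerate (unbounded in some directions), but always closed and with nonempty interior. For a quadratic function $V$, the Lie derivative along $x\mapsto Ax$ is $\mathcal{L}_AV(x)=V'(x)Ax$, i.e. $\mathcal{L}_AV(x)=x^\top(A^\top Q+QA)x+2b^\top Ax$. Escaping time: for $x_0\in\mathcal{R}$, let $\xi(t,x_0)=e^{tA}x_0$ be the solution of $\dot x=Ax$ with $x(0)=x_0$. Then $t_*(x_0,\mathcal{R};A)=\min\{t\ge0:\xi(t,x_0)\in\mathrm{bd}\,\mathcal{R}\}$, with the convention that $t_*(x_0,\mathcal{R};A)=0$ if $\xi(t,x_0)\in\mathrm{int}\,\mathcal{R}$ for all $t\ge0$. Here $\mathrm{bd}$ and $\mathrm{int}$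 denote topological boundary and interior. *)

(* Defs.v *)
From HB Require Import structures.
From mathcomp Require Import all_boot all_order all_algebra.
From mathcomp Require Import complex.
From mathcomp Require Import all_classical all_reals all_analysis.

Set Implicit Arguments.
Unset Strict Implicit.
Unset Printing Implicit Defensive.

Import Order.TTheory GRing.Theory Num.Theory.
Import numFieldNormedType.Exports.

Local Open Scope classical_set_scope.
Local Open Scope ring_scope.

Section Definitions.
Context {R : realType} {n : nat}.
Implicit Types (A Q : 'M[R]_n) (b x : 'cV[R]_n) (V : 'cV[R]_n -> R)
  (S : set 'cV[R]_n).

(* The eigenvalues of the real matrix A are its complex eigenvalues. *)
Definition strictly_stable A : Prop :=
  forall z : R[i]%C, eigenvalue (map_mx (real_complex R) A) z -> complex.Re z < 0.

Definition symmetric_mx Q : Prop := Q^T = Q.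

Definition psd_mx Q : Prop := forall x, 0 <= (x^T *m Q *m x) 0 0.

Definition quadratic_fun Q b (c : R) x : R :=
  (x^T *m Q *m x) 0 0 + 2 * (b^T *m x) 0 0 + c.

Definition convex_quadratic V : Prop :=
  exists Q b c, [/\ symmetric_mx Q, psd_mx Q & V = quadratic_fun Q b c].

Definition sublevel0 V : set 'cV[R]_n := [set x | V x <= 0].

(* Closedness is automatic for a sublevel set of a quadratic function; only
   the nonempty interior is a genuine restriction. *)
Definition ellipsoid S : Prop :=
  [/\ exists2 V, convex_quadratic V & S = sublevel0 V,
      closed S & interior S !=set0].

Definition convex_hull S : set 'cV[R]_n := smallest (@convex_set R 'cV[R]_n) S.

Definition boundary S : set 'cV[R]_n := closure S `\` interior S.

(* V'(x) A x, with V'(x) the Frechet derivative; see lie_derivativeE. *)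
Definition lie_derivative A V x : R := 'd (V : 'cV[R]_n -> R^o) x (A *m x).

Definition expmx A : 'M[R]_n :=
  limn (series (fun k => (k`!%:R)^-1 *: (A ^+ k) : 'M[R]_n)).

Definition flow A (x0 : 'cV[R]_n) (t : R) : 'cV[R]_n := expmx (t *: A) *m x0.

Definition boundary_times A S x0 : set R :=
  [set t | 0 <= t /\ boundary S (flow A x0 t)].

(* The infimum is a minimum whenever boundary_times is nonempty
   (escape_time_min), and this is the case if x0 lies in S and the first branch
   does not apply (boundary_times_nonempty). *)
Definition escape_time x0 S A : R :=
  if `[< forall t, 0 <= t -> interior S (flow A x0 t) >] then 0
  else inf (boundary_times A S x0).

Lemma quadratic_funE Q b c x : quadratic_fun Q b c x =
  \sum_i \sum_j Q i j * (x i 0 * x j 0) + 2 * (\sum_i b i 0 * x i 0) + c.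
Proof.
rewrite /quadratic_fun; congr (_ + 2 * _ + _).
  rewrite -mulmxA mxE; apply: eq_bigr => i _.
  rewrite !mxE mulr_sumr; apply: eq_bigr => j _.
  by rewrite mulrCA.
by rewrite mxE; apply: eq_bigr => i _; rewrite mxE.
Qed.

Let coord (i : 'I_n) (y : 'cV[R]_n) : R^o := y i 0.

Let is_diff_coord (i : 'I_n) x : is_diff x (coord i) (coord i).
Proof.
have L : linear (coord i) by move=> a u v; rewrite /coord !mxE.
pose f : {linear 'cV[R]_n -> R^o} :=
  HB.pack (coord i) (GRing.isLinear.Build _ _ _ _ (coord i) L).
have cf : continuous f by move=> y; exact: coord_continuous.
apply: DiffDef; first exact: (@linear_differentiable _ _ _ f).
exact: (@diff_lin _ _ _ f).
Qed.

Let is_diff_big (I : finType) (f df : I -> 'cV[R]_n -> R^o) x :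
  (forall i, is_diff x (f i) (df i)) ->
  is_diff x (\sum_i f i) (\sum_i df i).
Proof.
move=> fdf; elim/big_ind2: _ => [|g dg h dh Hg Hh|i _]; last exact: fdf.
- exact: is_diff_cst.
- exact: is_diffD.
Qed.

Let is_diff_quadratic Q b c x :
  is_diff x (quadratic_fun Q b c : 'cV[R]_n -> R^o)
    (fun h => \sum_i \sum_j Q i j * (x i 0 * h j 0 + x j 0 * h i 0)
              + 2 * (\sum_i b i 0 * h i 0)).
Proof.
have -> : (quadratic_fun Q b c : 'cV[R]_n -> R^o) =
    \sum_i \sum_j Q i j *: (coord i * coord j)
    + 2 *: (\sum_i b i 0 *: coord i) + cst c.
  apply/funext => y; rewrite quadratic_funE !fctE !fct_sumE.
  congr (_ + 2 * _ + _).
  by apply: eq_bigr => i _; rewrite fct_sumE.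
have D1 : is_diff x (\sum_i \sum_j Q i j *: (coord i * coord j))
    (\sum_i \sum_j Q i j *: (coord i x *: coord j + coord j x *: coord i)).
  apply: is_diff_big => i; apply: is_diff_big => j.
  exact: (is_diffZ _ (is_diffM _ _)).
have D2 : is_diff x (\sum_i b i 0 *: coord i) (\sum_i b i 0 *: coord i).
  by apply: is_diff_big => i; apply: is_diffZ.
apply: (is_diff_eq (is_diffD (is_diffD D1 (is_diffZ 2 D2)) (is_diff_cst c x))).
apply/funext => y; rewrite addr0 !fctE !fct_sumE.
congr (_ + 2 * _).
by apply: eq_bigr => i _; rewrite fct_sumE.
Qed.

Lemma differentiable_quadratic Q b c x :
  differentiable (quadratic_fun Q b c : 'cV[R]_n -> R^o) x.
Proof. by have := is_diff_quadratic Q b c x; case. Qed.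

Lemma lie_derivativeE A Q b c x : symmetric_mx Q ->
  lie_derivative A (quadratic_fun Q b c) x =
  (x^T *m (A^T *m Q + Q *m A) *m x) 0 0 + 2 * (b^T *m A *m x) 0 0.
Proof.
move=> sQ; rewrite /lie_derivative.
case: (is_diff_quadratic Q b c x) => _ ->.
congr (_ + 2 * _); last first.
  by rewrite -mulmxA [RHS]mxE; apply: eq_bigr => i _; rewrite [b^T _ _]mxE.
rewrite mulmxDr mulmxDl [RHS]mxE addrC.
have E (y z : 'cV[R]_n) :
    (y^T *m Q *m z) 0 0 = \sum_i \sum_j Q i j * (y i 0 * z j 0).
  rewrite -mulmxA mxE; apply: eq_bigr => i _.
  by rewrite !mxE mulr_sumr; apply: eq_bigr => j _; rewrite mulrCA.
rewrite !mulmxA -trmx_mul E -[x^T *m Q *m A *m x]mulmxA E -big_split.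
apply: eq_bigr => i _; rewrite -big_split; apply: eq_bigr => j _ /=.
by rewrite mulrDr [x j 0 * _]mulrC.
Qed.


Let expcoef A m i j : R^nat := fun k => (k`!%:R)^-1 * (A ^+ (k + m)) i j.

Let expmx_entry_bound A :
  exists2 C : R, 0 <= C & forall k i j, `|(A ^+ k) i j| <= C ^+ k.
Proof.
pose C := \sum_i \sum_j `|A i j|.
have C0 : 0 <= C by apply: sumr_ge0 => i _; apply: sumr_ge0.
have AC i : \sum_j `|A i j| <= C.
  rewrite /C [leRHS](bigD1 i)//= lerDl.
  by apply: sumr_ge0 => l _; apply: sumr_ge0.
exists C => //; elim=> [|k IH] i j.
  by rewrite !expr0 mxE; case: (_ == _); rewrite ?normr1 ?normr0.
rewrite exprS mxE (le_trans (ler_norm_sum _ _ _))//.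
rewrite exprS (@le_trans _ _ (\sum_l `|A i l| * C ^+ k))//.
  by apply: ler_sum => l _; rewrite normrM ler_wpM2l.
by rewrite -mulr_suml ler_wpM2r// exprn_ge0.
Qed.


Let cvg_expcoef A m i j t : cvgn (pseries (expcoef A m i j) t).
Proof.
have [C C0 HC] := expmx_entry_bound A.
apply: normed_cvg; rewrite /normed_series_of /=.
apply: (@series_le_cvg _ _ (C ^+ m *: exp_coeff (C * `|t|))).
- by move=> k /=.
- by move=> k; rewrite mulr_ge0 ?exprn_ge0// exp_coeff_ge0// mulr_ge0.
- move=> k; rewrite /exp_coeff /= fctE /expcoef.
  rewrite !normrM normfV normr_nat normrX.
  rewrite [leRHS](_ : _ = (k`!%:R)^-1 * C ^+ (k + m) * `|t| ^+ k).
    by rewrite ler_wpM2r ?exprn_ge0// ler_wpM2l ?invr_ge0.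
  rewrite exprD exprMn -[LHS]/(C ^+ m * (C ^+ k * `|t| ^+ k / k`!%:R)).
  by rewrite [LHS]mulrA [LHS]mulrC -[RHS]mulrA; congr (_ * _); rewrite -mulrA mulrCA.
- by apply: is_cvg_seriesZ; exact: is_cvg_series_exp_coeff.
Qed.

Let diffs_expcoef A m i j :
  pseries_diffs (expcoef A m i j) = expcoef A m.+1 i j.
Proof.
apply/funext => k; rewrite /pseries_diffs /expcoef addSnnS mulrA; congr (_ * _).
by rewrite factS natrM invfM mulVKf.
Qed.

Let continuous_expcoef A i j :
  continuous (fun t => limn (pseries (expcoef A 0 i j) t)).
Proof.
move=> t; apply: differentiable_continuous; apply/derivable1_diffP.
suff D : is_derive t (1 : R) (fun t => limn (pseries (expcoef A 0 i j) t))
    (limn (pseries (pseries_diffs (expcoef A 0 i j)) t)) by exact: ex_derive.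
apply: (@pseries_snd_diffs _ _ (`|t| + 1));
  rewrite ?diffs_expcoef; do ?exact: cvg_expcoef.
by rewrite [ltRHS]ger0_norm// ltrDl.
Qed.

Let cvg_mx (T : Type) (F : set_system T) (FF : Filter F) (p q : nat)
    (f : T -> 'M[R]_(p, q)) (M : 'M[R]_(p, q)) :
  (forall i j, f x i j @[x --> F] --> M i j) -> f x @[x --> F] --> M.
Proof.
move=> fM; apply/cvgrPdist_le => /= e e0; near=> x.
rewrite /Num.Def.normr/= mx_normrE (bigmax_le _ (ltW e0))//= => i _.
rewrite !mxE/=.
move: i; near: x; apply: filter_forall => /= i.
exact: ((cvgrPdist_le _ _).1 (fM i.1 i.2)).
Unshelve. all: by end_near. Qed.

Let expr_scalemx A (t : R) k : (t *: A) ^+ k = t ^+ k *: A ^+ k.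
Proof.
elim: k => [|k IH]; first by rewrite !expr0 scale1r.
by rewrite !exprS IH -[LHS]/(_ *m _) -scalemxAl -scalemxAr scalerA.
Qed.

Let cvg_expmx A (t : R) :
  series (fun k => (k`!%:R)^-1 *: ((t *: A) ^+ k) : 'M[R]_n) @ \oo -->
  (\matrix_(i, j) limn (pseries (expcoef A 0 i j) t)).
Proof.
apply: cvg_mx => i j; rewrite mxE.
rewrite [X in X @ _ --> _](_ : _ = pseries (expcoef A 0 i j) t).
  exact: cvg_expcoef.
apply/funext => k; rewrite /series /= summxE; apply: eq_bigr => l _.
by rewrite /= /expcoef addn0 expr_scalemx !mxE -!mulrA [_ * t ^+ _]mulrC.
Qed.

Let expmxE A t i j :
  expmx (t *: A) i j = limn (pseries (expcoef A 0 i j) t).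
Proof. by have /cvg_lim := @cvg_expmx A t; rewrite /expmx => -> //; rewrite mxE. Qed.

Lemma is_cvg_expmx A :
  cvgn (series (fun k => (k`!%:R)^-1 *: (A ^+ k) : 'M[R]_n)).
Proof. by have /cvgP := @cvg_expmx A 1; rewrite scale1r. Qed.

Lemma continuous_flow A x0 : continuous (flow A x0).
Proof.
have flowE t i j : flow A x0 t i j =
    \sum_k limn (pseries (expcoef A 0 i k) t) * x0 k j.
  by rewrite mxE; apply: eq_bigr => k _; rewrite expmxE.
move=> t; apply: cvg_mx => i j; rewrite flowE; under eq_fun do rewrite flowE.
apply: (@continuous_big R _ +%R 0 xpredT add_continuous _ _
  (fun k t => limn (pseries (expcoef A 0 i k) t) * x0 k j)) => k _ s.
by apply: cvgM; [exact: continuous_expcoef|exact: cvg_cst].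
Qed.

Let closed_inf (B : set R) : closed B -> B !=set0 -> has_lbound B -> B (inf B).
Proof.
move=> cB B0 Blb; apply: cB => U /nbhs_ballP[e /= e0 eU].
have [t Bt te] := inf_adherent e0 (conj B0 Blb).
exists t; split=> //; apply: eU; rewrite /ball /= ltr_distlC.
apply/andP; split=> //; rewrite (lt_le_trans _ (ge_inf Blb Bt))//.
by rewrite ltrBlDr ltrDl.
Qed.

Let closed_flow_times A S x0 :
  closed S -> closed [set t | 0 <= t /\ S (flow A x0 t)].
Proof.
move=> cS; rewrite (_ : [set t | _] = [set t | 0 <= t] `&` flow A x0 @^-1` S)//.
apply: closedI; first exact: closed_ge.
by apply: preimage_closed => // t _; exact: continuous_flow.
Qed.

Lemma escape_time_min A S x0 : boundary_times A S x0 !=set0 ->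
  boundary_times A S x0 (escape_time x0 S A) /\
  lbound (boundary_times A S x0) (escape_time x0 S A).
Proof.
move=> B0; rewrite /escape_time; case: asboolP => [I|_].
  by case: B0 => t [/I St [_]].
have Blb : has_lbound (boundary_times A S x0) by exists 0 => t [].
split; last by move=> t Bt; exact: ge_inf.
apply: closed_inf => //; apply: closed_flow_times; apply: closedI.
  exact: closed_closure.
by apply: open_closedC; exact: open_interior.
Qed.

Lemma flow0 A x0 : flow A x0 0 = x0.
Proof.
rewrite /flow scale0r; suff -> : expmx (0 : 'M[R]_n) = 1%:M by rewrite mul1mx.
apply: cvg_lim => //; apply: cvg_near_cst.
near=> k; have k0 : (0 < k)%N by near: k; exact: nbhs_infty_gt.
rewrite -(prednK k0) /series /= big_nat_recl//= big1_seq ?addr0.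
  by rewrite expr0 invr1 scale1r.
by move=> i _; rewrite exprS mul0r scaler0.
Unshelve. all: by end_near. Qed.

Lemma boundary_times_nonempty A S x0 : S x0 ->
  ~ (forall t, 0 <= t -> interior S (flow A x0 t)) ->
  boundary_times A S x0 !=set0.
Proof.
move=> Sx0 nI; pose C := [set t | 0 <= t /\ (~` interior S) (flow A x0 t)].
have cC : closed C.
  by apply: closed_flow_times; apply: open_closedC; exact: open_interior.
have C0 : C !=set0.
  by move/existsNP : nI => [t /not_implyP[t0 It]]; exists t.
have Clb : has_lbound C by exists 0 => t [].
have [t0 It] := closed_inf cC C0 Clb.
exists (inf C); split=> //; split=> //.
have [t_eq0|t_neq0] := eqVneq (inf C) 0.
  by rewrite t_eq0 flow0; exact: subset_closure.
have {t_neq0}t_gt0 : 0 < inf C by rewrite lt_neqAle eq_sym t_neq0.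
move=> U /(@continuous_flow A x0 (inf C))/nbhs_ballP[e /= e0 eU].
pose s := Num.max 0 (inf C - e / 2).
have s_ge0 : 0 <= s by rewrite le_max lexx.
have s_lt : s < inf C by rewrite gt_max t_gt0 ltrBlDr ltrDl divr_gt0.
exists (flow A x0 s); split; last first.
  apply: eU; rewrite /ball /= ger0_norm ?subr_ge0 ?ltW// ltrBlDr -ltrBlDl.
  by rewrite lt_max ltrD2l ltrN2 gtr_pMr// invf_lt1// ltr1n orbT.
apply: interior_subset; apply: contrapT => Is.
by have /(_ s) := ge_inf Clb; rewrite leNgt s_lt => /(_ (conj s_ge0 Is)).
Qed.

End Definitions.

Definition log_plus {R : realType} (a : R) : R := ln (Num.max a 1).

(* Main.v *)
(* Let T be the escape time of x0. The case T = 0 is trivial; otherwise the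
   trajectory x(t) meets the boundary at time T, where by continuity some E_i is
   nonnegative. The certificate inequalities for that i give V(x(T)) >= r and
   W(x(T)) >= 0. Since W decreases along trajectories, W(x(t)) >= 0 on [0, T],
   so V(x(t)) + t (resp. exp(2 gamma t) V(x(t))) decreases there; comparing its
   values at 0 and T bounds T in terms of V(x0). Finally V <= 1 on every F_i,
   hence on the convex hull by convexity of V. *)

Require Import Defs.
From mathcomp Require Import all_boot all_order all_algebra.
From mathcomp Require Import all_classical all_reals all_analysis.
From mathcomp Require Import ring lra.

Set Implicit Arguments.
Unset Strict Implicit.
Unset Printing Implicit Defensive.

Import Order.TTheory GRing.Theory Num.Theory.
Import numFieldNormedType.Exports.

Local Open Scope classical_set_scope.
Local Open Scope ring_scope.

Section Flow.
Context {R : realType} {n : nat}.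
Implicit Types (A : 'M[R]_n) (x : 'cV[R]_n) (t : R).

Lemma expr_scalemx A t k : (t *: A) ^+ k = t ^+ k *: A ^+ k.
Proof.
elim: k => [|k IH]; first by rewrite !expr0 scale1r.
by rewrite !exprS IH -[LHS]/(_ *m _) -scalemxAl -scalemxAr scalerA.
Qed.

(** Taylor coefficients at $0$ of the $i$-th coordinate of $t \mapsto e^{tA}x$: coordinatewise, the
    calculus of scalar power series applies. *)
Definition flow_coef A x (i : 'I_n) : R^nat :=
  fun k => (k`!%:R)^-1 * (A ^+ k *m x) i 0.

Lemma cvg_linear_comb (u : 'I_n -> R^nat) (l c : 'I_n -> R) :
  (forall j, u j @ \oo --> l j) ->
  (fun k => \sum_j u j k * c j) @ \oo --> \sum_j l j * c j.
Proof.
move=> ul.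
apply: (@cvg_big R _ +%R 0 xpredT add_continuous _ _ _ (fun j k => u j k * c j)
  (fun j => l j * c j)) => j _.
by apply: cvgM; [exact: ul | exact: cvg_cst].
Qed.

(** Exchanging finite sums turns a partial sum into coordinate [i] of a partial sum of $e^{tA}$
    applied to [x]. *)
Lemma cvg_flow_pseries A x t i :
  pseries (flow_coef A x i) t @ \oo --> flow A x t i 0.
Proof.
rewrite /flow mxE.
have -> : pseries (flow_coef A x i) t = (fun k => \sum_j
   (series (fun k => (k`!%:R)^-1 *: ((t *: A) ^+ k) : 'M[R]_n) k) i j * x j 0).
  apply/funext => k; rewrite /pseries /series /=.
  under [RHS]eq_bigr do rewrite summxE mulr_suml.
  rewrite [RHS]exchange_big; apply: eq_bigr => l _ /=.
  rewrite /flow_coef mxE mulr_sumr mulr_suml; apply: eq_bigr => j _.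
  by rewrite expr_scalemx !mxE; ring.
apply: (@cvg_linear_comb (fun j k =>
    series (fun k => (k`!%:R)^-1 *: ((t *: A) ^+ k) : 'M[R]_n) k i j)
  (fun j => expmx (t *: A) i j)) => j.
exact: cvg_comp _ _ (@is_cvg_expmx R n (t *: A))
  (@coord_continuous R n n i j _).
Qed.

(** [A] commutes with its powers, so the two series agree term by term. *)
Lemma flow_mulmx A x t : flow A (A *m x) t = A *m flow A x t.
Proof.
apply/colP => i; have /cvg_lim <- // := @cvg_flow_pseries A (A *m x) t i.
apply/cvg_lim => //; rewrite mxE; under [X in _ --> X]eq_bigr do rewrite mulrC.
have -> : pseries (flow_coef A (A *m x) i) t =
    (fun k => \sum_j pseries (flow_coef A x j) t k * A i j).
  apply/funext => k; rewrite /pseries /series /=.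
  under [RHS]eq_bigr do rewrite mulr_suml.
  rewrite [RHS]exchange_big; apply: eq_bigr => l _ /=.
  have AE : A ^+ l *m (A *m x) = A *m (A ^+ l *m x).
    rewrite !mulmxA; congr (_ *m _).
    by rewrite -[LHS]/(_ * _) -[RHS]/(_ * _) -exprS -exprSr.
  rewrite /flow_coef AE mxE mulr_sumr mulr_suml.
  by apply: eq_bigr => j _; ring.
by apply: cvg_linear_comb => j; exact: (@cvg_flow_pseries).
Qed.

(** Termwise differentiation shifts the coefficients, which amounts to replacing [x] by [A *m x];
    [flow_mulmx] then moves [A] out of the flow. *)
Lemma is_derive_flow_coord A x t i :
  is_derive t (1 : R) (fun s => flow A x s i 0) ((A *m flow A x t) i 0).
Proof.
have cvgS y s j : cvgn (pseries (flow_coef A y j) s).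
  by apply/cvg_ex; eexists; exact: (@cvg_flow_pseries).
have limS y j : (fun s => limn (pseries (flow_coef A y j) s)) =
      (fun s => flow A y s j 0).
  by apply/funext => s; apply/cvg_lim => //; exact: (@cvg_flow_pseries).
have diffS y j : pseries_diffs (flow_coef A y j) = flow_coef A (A *m y) j.
  apply/funext => k; rewrite /pseries_diffs /flow_coef mulrA.
  rewrite exprSr -[_ * A]/(_ *m _) -mulmxA; congr (_ * _).
  by rewrite factS natrM invfM mulVKf.
rewrite -flow_mulmx -limS -(congr1 (@^~ t) (limS (A *m x) i)) -diffS.
(* The series converge everywhere, so any radius exceeding the modulus of [t] will do. *)
by apply: (@pseries_snd_diffs _ _ (`|t| + 1)); rewrite ?diffS//
  [ltRHS]ger0_norm// ltrDl.
Qed.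

(** The coordinate derivatives are assembled into a differential, the form that the chain rule with
    [V] requires. *)
Lemma is_diff_flow A x t :
  is_diff t (flow A x) (fun h => h *: (A *m flow A x t)).
Proof.
have D : derivable (flow A x) t (1 : R).
  apply/derivable_mxP => i j; rewrite ord1.
  by case: (is_derive_flow_coord A x t i).
have dD : differentiable (flow A x) t by apply/derivable1_diffP.
apply: DiffDef => //; rewrite diff1E//; apply/funext => h; congr (_ *: _).
rewrite derive1E derive_mx//; apply/matrixP => i j; rewrite mxE ord1.
by case: (is_derive_flow_coord A x t i).
Qed.

Lemma is_derive_quadratic_flow A x t (V : 'cV[R]_n -> R) : convex_quadratic V ->
  is_derive t (1 : R) (fun s => V (flow A x s))
    (lie_derivative A V (flow A x t)).
Proof.
move=> [Q [b [c [_ _ ->]]]]; set W := quadratic_fun Q b c.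
have dW : is_diff (flow A x t) (W : _ -> R^o) ('d (W : _ -> R^o) (flow A x t)).
  by apply: DiffDef => //; exact: differentiable_quadratic.
have [dWf eWf] := is_diff_comp (is_diff_flow A x t) dW.
split; first by apply/derivable1_diffP.
by rewrite deriveE// eWf /= scale1r.
Qed.

Lemma continuous_quadratic (V : 'cV[R]_n -> R) :
  convex_quadratic V -> continuous V.
Proof.
move=> [Q [b [c [_ _ ->]]]] x.
exact: (differentiable_continuous (differentiable_quadratic Q b c x)).
Qed.

End Flow.

Lemma convex_sublevel (R : realType) n (V : 'cV[R]_n -> R) (a : R) :
  convex_quadratic V -> @convex_set R 'cV[R]_n [set x | V x <= a].
Proof.
move=> [Q [b [c [sQ pQ ->]]]] x y l /set_mem /= Vx /set_mem /= Vy.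
apply/mem_set; rewrite /= -[conv l x y]/(l%:inum *: x + (1 - l%:inum) *: y).
have l0 : 0 <= l%:num by [].
have l1 : l%:num <= 1 by [].
move: l%:num l0 l1 => s s0 s1.
(* s q(x) + (1-s) q(y) - q(s x + (1-s) y) = s (1-s) q(x-y) for q = x^T Q x *)
have := pQ (x - y); move: Vx Vy; rewrite /quadratic_fun.
have -> : (s *: x + (1 - s) *: y)^T = s *: x^T + (1 - s) *: y^T.
  by apply/matrixP => i j; rewrite !mxE.
have -> : (x - y)^T = x^T - y^T by apply/matrixP => i j; rewrite !mxE.
rewrite !(mulmxDl, mulmxDr, mulNmx, mulmxN, =^~ scalemxAl, =^~ scalemxAr) /=.
rewrite !mxE.
move: (\sum_j (x^T *m Q) 0 j * x j 0) (\sum_j (x^T *m Q) 0 j * y j 0)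
  (\sum_j (y^T *m Q) 0 j * x j 0) (\sum_j (y^T *m Q) 0 j * y j 0)
  (\sum_j b^T 0 j * x j 0) (\sum_j b^T 0 j * y j 0).
move=> xx xy yx yy bx b_y Vx Vy qxy.
have s1' : 0 <= 1 - s by rewrite subr_ge0.
(* With the bilinear terms opaque, the goal is the sum of three inequalities weighted by
   [s * (1 - s)], [s] and [1 - s]. *)
have := mulr_ge0 (mulr_ge0 s0 s1') qxy.
have := ler_wpM2l s0 Vx; have := ler_wpM2l s1' Vy.
by lra.
Qed.

(** The sign of [df] is asked for on [[a, b]] only, since $W \ge 0$ will be known only up to the
    exit time. *)
Lemma is_derive_le0_le (R : realType) (f df : R -> R) (a b : R) : a <= b ->
  (forall t, is_derive t (1 : R) f (df t)) ->
  (forall t, a <= t <= b -> df t <= 0) -> f b <= f a.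
Proof.
move=> ab fdf df0.
have D t : derivable f t (1 : R) by exact: ex_derive.
apply: (@ler0_derive1_le_cc _ f a b) => //; rewrite ?in_itv/= ?ab ?lexx//.
- move=> t; rewrite in_itv/= => /andP[/ltW t0 /ltW tT].
  by rewrite derive1E derive_val df0// t0.
- exact: derivable_within_continuous.
Qed.

(** If every [E i y] were negative, continuity and the finiteness of the family would give a
    neighbourhood of [y] inside [S]. *)
Lemma exists_active_constraint (R : realType) (T : topologicalType) N
    (E : 'I_N -> T -> R) (S : set T) y :
  (forall i, continuous (E i)) ->
  (forall x, S x <-> forall i, E i x <= 0) -> ~ interior S y ->
  exists i, 0 <= E i y.
Proof.
move=> cE SE Sy; apply: contrapT => /forallNP Ey; apply: Sy.
suff : \forall x \near y, forall i, E i x <= 0 by apply: filterS => x /SE.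
apply: (@filter_forall _ _ (fun i x => E i x <= 0) (nbhs y)) => i.
have Ei : E i y < 0 by rewrite ltNge; apply/negP/Ey.
exact: cvgr_le (cE i y) _ Ei.
Qed.

(** Either the convention for trajectories that stay in the interior gives [0], or the infimum is
    attained. *)
Lemma escape_time_boundary (R : realType) n (A : 'M[R]_n) S x0 : S x0 ->
  escape_time x0 S A = 0 \/
  0 <= escape_time x0 S A /\ boundary S (flow A x0 (escape_time x0 S A)).
Proof.
move=> Sx0.
have [I|I] := pselect (forall t, 0 <= t -> interior S (flow A x0 t)).
  by left; rewrite /escape_time asboolT.
by right; have [] := escape_time_min (boundary_times_nonempty Sx0 I).
Qed.

Lemma log_plus_ge0 (R : realType) (a : R) : 0 <= log_plus a.
Proof. by rewrite ln_ge0// le_max lexx orbT. Qed.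

(** The maximum with [1] keeps both arguments of [ln] positive, whatever the signs of [a] and
    [b]. *)
Lemma le_log_plus (R : realType) (a b : R) : a <= b -> log_plus a <= log_plus b.
Proof.
move=> ab; rewrite /log_plus ler_ln ?posrE ?lt_max ?ltr01 ?orbT//.
by rewrite ge_max !le_max ab lexx !orbT.
Qed.

Theorem theorem4 (R : realType) (n N M : nat) (A : 'M[R]_n)
    (calR : set 'cV[R]_n)
    (calE : 'I_N -> set 'cV[R]_n) (calF : 'I_M -> set 'cV[R]_n)
    (E : 'I_N -> 'cV[R]_n -> R) (F : 'I_M -> 'cV[R]_n -> R)
    (V W : 'cV[R]_n -> R)
    (lambda : 'I_M -> R) (mu nu : 'I_N -> R) (r : R)
    (stableA : strictly_stable A)
    (closedR : closed calR)
    (convexR : @convex_set R 'cV[R]_n calR)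
    (R_int_nonempty : interior calR !=set0)
    (R_inter : calR = \bigcap_(i in [set: 'I_N]) calE i)
    (R_sub_conv : calR `<=` convex_hull (\bigcup_(i in [set: 'I_M]) calF i))
    (ellE : forall i, ellipsoid (calE i))
    (ellF : forall i, ellipsoid (calF i) \/ exists a, calF i = [set a])
    (quadE : forall i, convex_quadratic (E i))
    (quadF : forall i, convex_quadratic (F i))
    (calEE : forall i, calE i = [set x | E i x <= 0])
    (calFE : forall i, calF i = [set x | F i x <= 0])
    (R_int0 : interior calR 0)
    (quadV : convex_quadratic V)
    (quadW : convex_quadratic W)
    (lambda_ge0 : forall i, 0 <= lambda i)
    (mu_ge0 : forall i, 0 <= mu i)
    (nu_ge0 : forall i, 0 <= nu i)
    (V_le : forall x i, V x <= 1 + lambda i * F i x)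
    (V_ge : forall x i, r + mu i * E i x <= V x)
    (LW_le0 : forall x, lie_derivative A W x <= 0)
    (W_ge : forall x i, nu i * E i x <= W x) :
  ((forall x, lie_derivative A V x <= -1 - W x) ->
   forall x0, calR x0 ->
     escape_time x0 calR A <= Num.max (V x0 - r) 0 /\
     Num.max (V x0 - r) 0 <= Num.max (1 - r) 0)
  /\
  (forall gamma : R, 0 < gamma -> 0 < r ->
   (forall x, lie_derivative A V x <= - 2 * gamma * V x - W x) ->
   forall x0, calR x0 ->
     escape_time x0 calR A <= log_plus (V x0 / r) / (2 * gamma) /\
     log_plus (V x0 / r) / (2 * gamma) <= log_plus (1 / r) / (2 * gamma)).
Proof.
have V_le1 x : calR x -> V x <= 1.
  move=> /R_sub_conv cx; have /smallest_sub := @convex_sublevel R n V 1 quadV.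
  move=> /(_ (\bigcup_(i in [set: 'I_M]) calF i)); apply; last exact: cx.
  move=> {cx}x [i _]; rewrite calFE /= => Fx; rewrite (le_trans (V_le x i))//.
  by rewrite gerDl mulr_ge0_le0.
have calRE x : calR x <-> forall i, E i x <= 0.
  rewrite R_inter; split=> [Rx i|Rx i _]; last by rewrite calEE; exact: Rx.
  by have := Rx i I; rewrite calEE.
have exit x0 T : 0 <= T -> boundary calR (flow A x0 T) ->
    r <= V (flow A x0 T) /\ forall t, 0 <= t <= T -> 0 <= W (flow A x0 t).
  move=> T0 [_ nI]; have cE i : continuous (E i) by exact: continuous_quadratic.
  have [i Ei] := exists_active_constraint cE calRE nI; split=> [|t /andP[_ tT]].
    by apply: le_trans (V_ge _ i); rewrite lerDl mulr_ge0.
  (* The sign of [W] at time [T] propagates backwards, because [W] is nonincreasing along the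
     flow. *)
  apply: le_trans (le_trans (mulr_ge0 (nu_ge0 i) Ei) (W_ge _ i)) _.
  exact: (is_derive_le0_le tT
    (fun s => is_derive_quadratic_flow A x0 s quadW)).
split=> [LV x0 Rx0|gamma gamma0 r0 LV x0 Rx0].
  split; last by rewrite ge_max !le_max lexx orbT lerD2r V_le1.
  have [->|[]] := escape_time_boundary A Rx0.
    by rewrite le_max lexx orbT.
  move: (escape_time _ _ _) => T T0 /(exit _ _ T0)[rV W0].
  rewrite le_max; apply/orP; left; rewrite lerBrDr -lerBrDl.
  have D s : is_derive s (1 : R) (fun s => V (flow A x0 s) + s)
      (lie_derivative A V (flow A x0 s) + 1).
    by apply: is_deriveD; exact: is_derive_quadratic_flow.
  suff : V (flow A x0 T) + T <= V (flow A x0 0) + 0 by rewrite flow0; lra.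
  apply: (is_derive_le0_le T0 D) => t tT.
  by have := LV (flow A x0 t); have := W0 t tT; lra.
split; last first.
  rewrite ler_pM2r ?invr_gt0 ?mulr_gt0//; apply: le_log_plus.
  by rewrite ler_pM2r ?invr_gt0// V_le1.
have [->|[]] := escape_time_boundary A Rx0.
  by rewrite divr_ge0 ?log_plus_ge0 // mulr_ge0 ?ltW.
move: (escape_time _ _ _) => T T0 /(exit _ _ T0)[rV W0].
(* The integrating factor [expR (k * s)] absorbs the term [- k * V] of the bound on the Lie
   derivative. *)
pose k := 2 * gamma; have k0 : 0 < k by rewrite mulr_gt0.
pose f s := expR (k * s) * V (flow A x0 s).
have D s : is_derive s (1 : R) f
    (expR (k * s) * (lie_derivative A V (flow A x0 s) + k * V (flow A x0 s))).
  have dV := is_derive_quadratic_flow A x0 s quadV.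
  have dk : is_derive s (1 : R) (fun s => k * s) k.
    apply: (is_derive_eq (is_deriveZ k (is_derive_id s (1 : R)))).
    by rewrite /GRing.scale /= mulr1.
  have dE := is_derive1_comp (is_derive_expR (k * s)) dk.
  apply: (is_derive_eq (is_deriveM dE dV)).
  by rewrite /GRing.scale /=; ring.
have fT : expR (k * T) * r <= V x0.
  apply: (@le_trans _ _ (f T)); first by rewrite ler_wpM2l// expR_ge0.
  have -> : V x0 = f 0 by rewrite /f mulr0 expR0 mul1r flow0.
  apply: (is_derive_le0_le T0 D) => t tT.
  apply: mulr_ge0_le0; first exact: expR_ge0.
  by have := LV (flow A x0 t); have := W0 t tT; rewrite /k; lra.
(* Writing [k * T] as [ln (expR (k * T))] reduces the bound to [expR (k * T) <= V x0 / r], which is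
   [fT] divided by [r]. *)
rewrite ler_pdivlMr// mulrC -/k -[leLHS]expRK /log_plus.
by rewrite ler_ln ?posrE ?expR_gt0 ?lt_max ?ltr01 ?orbT// le_max ler_pdivlMr//
  fT.
Qed.
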